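(* Let $\Omega\subset\mathbb{R}^d$, $d\in\{2,3\}$, be an open connected bounded domain with smooth boundary, and let $W$ be a given smooth real-valued function on $\partial\Omega$. Let $Z_2>0$ and $I_1>0$ be given (independent of $\epsilon$). For each $\epsilon>0$ let $\Phi^*_\epsilon$ be the unique solution of the (nonlocal) Poisson-Boltzmann equation $$-\epsilon\Delta\Phi^*_\epsilon=\rho^*_\epsilon\quad\text{in }\Omega,\qquad \rho^*_\epsilon=I_1\frac{e^{-\Phi^*_\epsilon}}{\int_\Omega e^{-\Phi^*_\epsilon}\,dx}-\frac{e^{\Phi^*_\epsilon}}{Z_2},$$ with boundary condition $\Phi^*_\epsilon|_{\partial\Omega}=W$. Then for each compact $K\subset\Omega$, $$\lim_{\epsilon\to0}\ \sup_{x\in K}|\rho^*_\epsilon(x)|=0.$$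
   Context: The function $W$ does not depend on $\epsilon$. ''Solution'' means a smooth (classical) solution on $\overline\Omega$; for each $\epsilon>0$ a unique solution of this boundary value problem exists. *)

(* Defs.v *)
From HB Require Import structures.
From mathcomp Require Export all_boot all_order all_algebra.
From mathcomp Require Export all_classical all_reals all_analysis.
Export Order.TTheory GRing.Theory Num.Theory numFieldNormedType.Exports.

Set Implicit Arguments.
Unset Strict Implicit.
Unset Printing Implicit Defensive.

Local Open Scope classical_set_scope.
Local Open Scope ring_scope.

Section lebesgue_tuple.
Context {R : realType}.
Local Notation T := (measurableTypeR R).

Definition tcons n (p : T * n.-tuple T) : n.+1.-tuple T :=
  [tuple of p.1 :: p.2].

Lemma measurable_tcons n : measurable_fun [set: T * n.-tuple T] (@tcons n).
Proof.
exact: (measurable_cons (@measurable_fst _ _ _ _) (@measurable_snd _ _ _ _)).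
Qed.

Definition lebesgue_tcons n
    (m : {sigma_finite_measure set (n.-tuple T) -> \bar R}) :
    set (n.+1.-tuple T) -> \bar R :=
  pushforward (@lebesgue_measure R \x m)%E (@tcons n).

Section instances.
Variables (n : nat) (m : {sigma_finite_measure set (n.-tuple T) -> \bar R}).
Local Open Scope ereal_scope.

Let lebesgue_tcons0 : lebesgue_tcons m set0 = 0.
Proof. by rewrite /lebesgue_tcons /pushforward preimage_set0 measure0. Qed.

Let lebesgue_tcons_ge0 A : 0 <= lebesgue_tcons m A.
Proof. by rewrite /lebesgue_tcons /pushforward measure_ge0. Qed.

Let lebesgue_tcons_sigma_additive : semi_sigma_additive (lebesgue_tcons m).
Proof.
have mt A : measurable A -> measurable (@tcons n @^-1` A).
  by move=> mA; rewrite -[X in measurable X]setTI; exact: measurable_tcons.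
move=> F mF tF mUF; rewrite /lebesgue_tcons /pushforward preimage_bigcup.
apply: measure_semi_sigma_additive.
- by move=> i; exact: mt.
- apply/trivIsetP => /= i j _ _ ij; rewrite -preimage_setI.
  by move/trivIsetP : tF => /(_ _ _ _ _ ij) ->//; rewrite preimage_set0.
- by rewrite -preimage_bigcup; exact: mt.
Qed.

HB.instance Definition _ := isMeasure.Build _ _ _ (lebesgue_tcons m)
  lebesgue_tcons0 lebesgue_tcons_ge0 lebesgue_tcons_sigma_additive.

Let lebesgue_tcons_sigma_finite : sigma_finite setT (lebesgue_tcons m).
Proof.
have /sigma_finiteP[F [TF ndF Foo]] := sigma_finiteT (@lebesgue_measure R).
have /sigma_finiteP[G [TG ndG Goo]] := sigma_finiteT m.
pose g (t : n.+1.-tuple T) : T * n.-tuple T := (thead t, [tuple of behead t]).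
have gK : cancel (@tcons n) g.
  by move=> [x t]; rewrite /g theadE; congr pair; exact: val_inj.
have mg : measurable_fun setT g.
  apply/measurable_fun_pair; last exact: measurable_behead.
  exact: measurable_tnth.
exists (fun i => g @^-1` (F i `*` G i)).
  rewrite -preimage_bigcup -[LHS](@preimage_setT _ _ g); congr (g @^-1` _).
  rewrite -setXTT TF TG predeqE => -[x y]; split=> [|[k _ []/= ? ?]]; last first.
    by split; exists k.
  move=> [/= [i _ Fix] [j _ Gjy]]; exists (maxn i j) => //; split.
    by move: x Fix; exact/subsetPset/ndF/leq_maxl.
  by move: y Gjy; exact/subsetPset/ndG/leq_maxr.
move=> i; have [mF Fi] := Foo i; have [mG Gi] := Goo i; split.
  by rewrite -[X in measurable X]setTI; apply: mg => //; exact: measurableX.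
rewrite /lebesgue_tcons /pushforward (_ : _ @^-1` _ = F i `*` G i).
  by rewrite product_measure1E// lte_mul_pinfty// ge0_fin_numE.
by apply/seteqP; split => p; rewrite /preimage /mkset gK.
Qed.

HB.instance Definition _ := Measure_isSigmaFinite.Build _ _ _
  (lebesgue_tcons m) lebesgue_tcons_sigma_finite.

End instances.

(* n-dimensional Lebesgue measure, restricted to the Borel (product)
   sigma-algebra: the n-fold product of the one-dimensional one, transported
   along (x, t) |-> x :: t. *)
Fixpoint lebesgue_tuple n : {sigma_finite_measure set (n.-tuple T) -> \bar R} :=
  match n with
  | 0 => \d_ [tuple]
  | n'.+1 => lebesgue_tcons (lebesgue_tuple n')
  end.

End lebesgue_tuple.

Section euclidean_space.
Context {R : realType} {d : nat}.
Implicit Types (A U Omega : set 'rV[R]_d) (f g : 'rV[R]_d -> R).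

Definition row_of_tuple (t : d.-tuple (measurableTypeR R)) : 'rV[R]_d :=
  \row_i tnth t i.

(* Lebesgue integral over A; 'rV[R]_d carries no measurable structure, so it is
   taken on d.-tuple R, through the coordinatewise identification of the two. *)
Definition integral_rV A f : R :=
  \int[lebesgue_tuple d]_(t in row_of_tuple @^-1` A) f (row_of_tuple t).

Definition frontier A : set 'rV[R]_d := closure A `\` interior A.

Definition partial (i : 'I_d) f : 'rV[R]_d -> R :=
  'D_(delta_mx 0 i : 'rV[R]_d) f.

Definition laplacian f (x : 'rV[R]_d) : R :=
  \sum_(i < d) partial i (partial i f) x.

(* C^k, for U open: all partial derivatives up to order k exist and are
   continuous at every point of U. *)
Fixpoint Ck U (k : nat) f : Prop :=
  match k with
  | 0 => forall x, U x -> {for x, continuous f}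
  | k'.+1 => (forall x, U x -> {for x, continuous f}) /\
      forall i : 'I_d,
        (forall x, U x -> derivable f x (delta_mx 0 i)) /\ Ck U k' (partial i f)
  end.

Definition smooth U f : Prop := forall k, Ck U k f.

(* Smoothness on an arbitrary subset A of R^d (a closed domain, a
   hypersurface): near each point of A, f agrees on A with a smooth function
   defined on an open set. The values of f outside A are irrelevant. *)
Definition smooth_on A f : Prop :=
  forall x, A x -> exists U g,
    [/\ open U, U x, smooth U g & forall y, A y -> U y -> f y = g y].

(* Local defining functions with nonvanishing gradient; in particular Omega
   lies on one side of its boundary. *)
Definition smooth_boundary Omega : Prop :=
  forall p, frontier Omega p -> exists U g,
    [/\ open U, U p, smooth U g, (exists i, partial i g p != 0) &
        forall x, U x -> (Omega x <-> g x < 0)].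

Definition PB_density Omega (I1 Z2 : R) (Phi : 'rV[R]_d -> R)
    (x : 'rV[R]_d) : R :=
  I1 * (expR (- Phi x) / integral_rV Omega (fun y => expR (- Phi y))) -
  expR (Phi x) / Z2.

Definition PB_solution Omega W (I1 Z2 eps : R) (Phi : 'rV[R]_d -> R) : Prop :=
  [/\ smooth_on (closure Omega) Phi,
      forall x, Omega x ->
        - eps * laplacian Phi x = PB_density Omega I1 Z2 Phi x &
      forall x, frontier Omega x -> Phi x = W x].

End euclidean_space.

(* Main.v *)
Require Import Defs.
From mathcomp Require Import measurable_realfun.
From mathcomp Require Import ring lra.

Set Implicit Arguments.
Unset Strict Implicit.
Unset Printing Implicit Defensive.

Local Open Scope classical_set_scope.
Local Open Scope ring_scope.

(** Write A for the integral of exp (- Phi) over Omega and let c be the constant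
    with exp (2 c) = I1 Z2 / A, that is, the value of Phi at which the local
    charge density vanishes. Then
      rho = - (exp c / Z2) (exp (Phi - c) - exp (c - Phi)),
    so the equation becomes eps Laplacian(w) = (exp c / Z2) (exp w - exp (- w)),
    an equation which w = Phi - c and w = c - Phi both satisfy
    (laplacian_signed_deviation). Only c remembers the nonlocal term, and it
    depends on eps; the proof has two steps.

    Bounds uniform in eps. Where w > 0 its Laplacian is positive, so w has no
    positive interior maximum: Phi lies between min (- M) c and max M c, where
    M bounds W on the boundary (Phi_between). If c > M, this gives Phi <= c
    in Omega, hence A >= exp (- c) |Omega|, and exp (2 c) A = I1 Z2 forces
    c <= ln (I1 Z2 / |Omega|). In the same way c < - M forces
    c >= ln (I1 Z2 / |Omega|). Hence c, and then Phi, stay in an interval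
    independent of eps (equilibrium_le, equilibrium_ge, Phi_bounds).

    Interior decay. Now eps Laplacian(w) >= k w where w > 0, with k > 0
    independent of eps, and w <= L. Comparison with the paraboloid
    L |x - x0|^2 / r^2 on a cube of radius r around x0 inside Omega gives
    w(x0) <= 2 L d eps / (k r^2) (interior_bound). A compact K has one radius r
    that serves all its points, so Phi - c, and with it rho, is O(eps) uniformly
    on K. *)

(** * Second derivatives at a maximum *)

Section second_derivative.
Context {R : realType}.

(** Otherwise p1, which vanishes at 0, is positive just to the right of 0, and
    by the mean value theorem p exceeds its maximum there. *)
Lemma second_derivative_le0_at_max (p p1 : R -> R) :
  (\forall t \near (0:R), is_derive t (1:R) p (p1 t)) -> derivable p1 0 1 ->
  (\forall t \near (0:R), p t <= p 0) -> 'D_1 p1 0 <= 0.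
Proof.
move=> dp dp1 pmax.
have [e /= e0 he] : exists2 e : R, 0 < e & forall t, `|t| < e ->
    is_derive t (1:R) p (p1 t) /\ p t <= p 0.
  have /nbhs_ballP[e /= e0 he] : \forall t \near (0:R),
    is_derive t (1:R) p (p1 t) /\ p t <= p 0 by apply: filterI.
  exists e; first exact: e0.
  move=> t te; apply: he; rewrite /ball /= sub0r normrN; exact: te.
have inN t : t \in `]-e, e[%R -> `|t| < e.
  by rewrite in_itv /= ltr_norml.
have p10 : p1 0 = 0.
  have H : is_derive (0:R) (1:R) p 0.
    apply: (@derive1_at_max R p (-e) e 0).
    - lra.
    - by move=> t /inN /he [[]].
    - by rewrite in_itv /=; lra.
    - by move=> t /inN /he [].
  have [H1 _] := he 0 (eq_ind_r (fun z => z < e) e0 (normr0 _)).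
  by rewrite -(@derive_val _ _ _ _ _ _ _ H1) (@derive_val _ _ _ _ _ _ _ H).
rewrite leNgt; apply/negP => D0.
have /nbhs_ballP[r /= r0 hr] : \forall h \near (0:R), h != 0 ->
    0 < h^-1 *: (p1 (h *: (1 : R^o) + 0) - p1 0).
  exact: (cvgr_gt _ dp1 _ D0).
pose m := Num.min e r / 2.
have m0 : 0 < m by rewrite divr_gt0 // lt_min e0 r0.
have mm : m < Num.min e r.
  by rewrite /m ltr_pdivrMr // mulr2n mulrDr mulr1 ltrDl lt_min e0 r0.
have [me mr] : m < e /\ m < r by move: mm; rewrite lt_min => /andP[].
have lte t : t \in `]0, m[%R -> `|t| < e.
  by rewrite in_itv /= => /andP[t0 tm]; rewrite gtr0_norm //; apply: lt_trans me.
have [c cm] : exists2 c, c \in `]0, m[%R & p m - p 0 = p1 c * (m - 0).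
  apply: MVT; [exact: m0|by move=> t /lte /he []|].
  apply: continuous_in_subspaceT => t; rewrite inE /= in_itv /= => /andP[t0 tm].
  have [[dt _] _] := he t (eq_ind_r (fun z => z < e) (le_lt_trans tm me) (ger0_norm t0)).
  exact/differentiable_continuous/derivable1_diffP.
have [c0 cm'] : 0 < c /\ c < m by move: cm; rewrite in_itv /= => /andP[].
rewrite subr0 => E.
have : 0 < p1 c.
  have := hr c; rewrite /ball /= sub0r normrN gtr0_norm //.
  move=> /(_ (lt_trans cm' mr) (lt0r_neq0 c0)).
  by rewrite p10 subr0 addr0 [c *: _]mulr1 pmulr_rgt0 // invr_gt0.
have := (he m (eq_ind_r (fun z => z < e) me (gtr0_norm m0))).2.
move=> H1 H2; have := mulr_gt0 H2 m0; rewrite -E; lra.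
Qed.

(** The parabola a (t + b)^2, up to a constant, touches h from above at 0.
    Allowing a <> 0 gives at once the maximum principle and the comparison with
    a paraboloid, without differentiating a difference of functions of several
    variables. *)
Lemma second_derivative_le_at_touching (h h1 : R -> R) (a b : R) :
  (\forall t \near (0:R), is_derive t (1:R) h (h1 t)) -> derivable h1 0 1 ->
  (\forall t \near (0:R), h t - a * (t + b) ^+ 2 <= h 0 - a * b ^+ 2) ->
  'D_1 h1 0 <= 2 * a.
Proof.
move=> dh dh1 hmax.
pose q (t : R) : R := a * (t + b) ^+ 2.
pose q1 (t : R) : R := 2 * a * (t + b).
have dq t : is_derive t (1:R) q (q1 t).
  rewrite /q /q1.
  apply: (@is_derive_eq _ _ _ (fun t : R => a * (t + b) ^+ 2)).
  by rewrite /GRing.scale /=; ring.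
have dq1 : is_derive (0:R) (1:R) q1 (2 * a).
  rewrite /q1; apply: (@is_derive_eq _ _ _ (fun t : R => 2 * a * (t + b))).
  by rewrite /GRing.scale /=; ring.
have : 'D_1 (h1 - q1) 0 <= 0.
  apply: (@second_derivative_le0_at_max (h - q)).
  - near=> t; have H : is_derive t (1:R) h (h1 t) by near: t.
    exact: (@is_deriveB _ _ _ h q t 1 (h1 t) (q1 t)).
  - by apply: derivableB; [exact: dh1|case: dq1].
  - apply: filterS hmax => t H; rewrite /q !fctE add0r; exact: H.
rewrite deriveB; [|exact: dh1|by case: dq1].
by rewrite (@derive_val _ _ _ _ _ _ _ dq1) subr_le0.
Unshelve. all: by end_near. Qed.

End second_derivative.

(** * Continuity at a point *)

Section continuity_at_a_point.
Context {R : realType} {T : topologicalType}.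
Implicit Types (f g : T -> R) (x : T).

Lemma near_eq_continuous_at f g x : (\forall y \near x, f y = g y) ->
  {for x, continuous f} -> {for x, continuous g}.
Proof.
move=> fg cf; change (g @ x --> g x); rewrite -(nbhs_singleton fg).
by apply: cvg_trans cf; exact: near_eq_cvg.
Qed.

Lemma continuous_at_affine f (a b : R) x :
  {for x, continuous f} -> {for x, continuous (fun y => a * f y + b)}.
Proof.
by move=> cf; apply: cvgD; [apply: cvgM; [exact: cvg_cst|exact: cf]|exact: cvg_cst].
Qed.

End continuity_at_a_point.

(** * Directional derivatives and functions of class C^k *)

Section directional_derivatives.
Context {R : realType} {V : normedModType R}.
Implicit Types (f : V -> R) (x v : V).

Lemma near_line x v (P : set V) : (\forall y \near x, P y) ->
  \forall t \near (0:R), P (t *: v + x).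
Proof.
have : (t *: v + x) @[t --> (0:R)] --> 0 *: v + x.
  by apply: cvgD; [exact: scalel_continuous|exact: cvg_cst].
by rewrite scale0r add0r => /[apply].
Qed.

Lemma is_derive_line f x v (t : R) : derivable f (t *: v + x) v ->
  is_derive t (1:R) (fun s => f (s *: v + x)) ('D_v f (t *: v + x)).
Proof.
have E : (fun h : R => h^-1 *: ((f \o shift (t *: v + x)) (h *: v) - f (t *: v + x))) =
    (fun h : R => h^-1 *: (((fun s => f (s *: v + x)) \o shift t) (h *: (1:R)) -
                           f (t *: v + x))).
  by apply/funext => h /=; rewrite [_%:A]mulr1 scalerDl addrA.
by rewrite /derivable /derive E => df; exact: DeriveDef.
Qed.

Lemma directional_second_derivative_le_at_touching f x v (a b : R) :
  (\forall y \near x, derivable f y v) -> derivable ('D_v f) x v ->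
  (\forall t \near (0:R),
     f (t *: v + x) - a * (t + b) ^+ 2 <= f x - a * b ^+ 2) ->
  'D_v ('D_v f) x <= 2 * a.
Proof.
move=> df ddf fmax.
have x0 : 0 *: v + x = x by rewrite scale0r add0r.
have [dD DE] : is_derive (0:R) (1:R) (fun s => 'D_v f (s *: v + x)) ('D_v ('D_v f) x).
  by rewrite -{2}x0; apply: is_derive_line; rewrite x0.
rewrite -DE; apply: (@second_derivative_le_at_touching _ _ _ a b _ dD).
  have := near_line v df; apply: filterS => t; exact: is_derive_line.
by apply: filterS fmax => t; rewrite x0.
Qed.

End directional_derivatives.

Section differential_calculus.
Context {R : realType} {d : nat}.
Implicit Types (U V : set 'rV[R]_d) (f g : 'rV[R]_d -> R).

(** Being C^k is a local property: partial derivatives at a point only depend on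
    the germ of the function. This turns smoothness up to the boundary, which is
    stated with local extensions, into differentiability of the function itself
    in the interior. *)
Lemma Ck_local U k f : open U ->
  (forall x, U x -> exists V g,
     [/\ open V, V x, Ck V k g & forall y, U y -> V y -> f y = g y]) ->
  Ck U k f.
Proof.
move=> oU.
have near_fg h x V g : U x -> open V -> V x -> (forall y, U y -> V y -> h y = g y) ->
    \forall y \near x, g y = h y.
  move=> Ux oV Vx fg; near=> y; apply/esym/fg; near: y; exact: open_nbhs_nbhs.
elim: k f => [|k IHk] f loc.
  move=> x Ux; have [V [g [oV Vx cg fg]]] := loc x Ux.
  exact: near_eq_continuous_at (near_fg _ _ _ _ Ux oV Vx fg) (cg x Vx).
split; [|move=> i; split].
- move=> x Ux; have [V [g [oV Vx [cg _] fg]]] := loc x Ux.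
  exact: near_eq_continuous_at (near_fg _ _ _ _ Ux oV Vx fg) (cg x Vx).
- move=> x Ux; have [V [g [oV Vx [_ dg] fg]]] := loc x Ux.
  apply: near_eq_derivable ((dg i).1 x Vx).
  exact: (near_fg _ _ _ _ Ux oV Vx fg).
- apply: IHk => x Ux; have [V [g [oV Vx [_ dg] fg]]] := loc x Ux.
  exists V, (partial i g); split=> //; first exact: (dg i).2.
  by move=> y Uy Vy; apply/esym/near_eq_derive; exact: near_fg oV Vy fg.
Unshelve. all: by end_near. Qed.

Lemma smooth_on_Ck A U k f : open U -> U `<=` A -> smooth_on A f -> Ck U k f.
Proof.
move=> oU UA sf; apply: Ck_local => // x Ux.
have [V [g [oV Vx sg fg]]] := sf x (UA _ Ux).
by exists V, g; split => // y Uy; exact/fg/UA.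
Qed.

Lemma smooth_on_continuous A f : smooth_on A f -> {within A, continuous f}.
Proof.
move=> sf; apply/subspace_continuousP => x Ax.
have [V [g [oV Vx sg fg]]] := sf x Ax.
have cg : g y @[y --> within A (nbhs x)] --> g x.
  have sgx : g @ x --> g x := sg 0%N x Vx.
  apply: cvg_within_filter; exact: sgx.
change (f @ within A (nbhs x) --> f x); rewrite (fg x Ax Vx).
apply: cvg_trans cg.
apply: (@near_eq_cvg _ _ (within A (nbhs x))); rewrite near_withinE.
by near=> y => Ay; rewrite fg //; near: y; exact: open_nbhs_nbhs.
Unshelve. all: by end_near. Qed.

Lemma partial_affine f (a b : R) i x : derivable f x (delta_mx 0 i) ->
  partial i (fun y => a * f y + b) x = a * partial i f x.
Proof.
move=> df; rewrite /partial.
have -> : (fun y => a * f y + b) = a \*: f + cst b by [].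
rewrite deriveD; [|exact: derivableZ|exact: derivable_cst].
by rewrite derive_cst addr0 deriveZ; last exact: df.
Qed.

Lemma derivable_affine f (a b : R) x v : derivable f x v ->
  derivable (fun y => a * f y + b) x v.
Proof.
move=> df; have -> : (fun y => a * f y + b) = a \*: f + cst b by [].
by apply: derivableD; [exact: derivableZ|exact: derivable_cst].
Qed.

Lemma Ck_affine U k f (a b : R) : open U -> Ck U k f ->
  Ck U k (fun x => a * f x + b).
Proof.
move=> oU; elim: k f b => [|k IHk] f b; first by move=> cf x /cf /continuous_at_affine.
move=> [cf df]; split; first by move=> x /cf /continuous_at_affine.
move=> i; have [di ki] := df i; split; first by move=> x /di /derivable_affine.
apply: Ck_local => // x Ux; exists U, (fun x => a * partial i f x + 0).
split=> //; first exact: IHk.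
by move=> y Uy _; rewrite addr0 partial_affine //; exact: di.
Qed.

Lemma laplacian_affine U f (a b : R) x : open U -> U x -> Ck U 2 f ->
  laplacian (fun y => a * f y + b) x = a * laplacian f x.
Proof.
move=> oU Ux [_ df]; rewrite /laplacian mulr_sumr; apply: eq_bigr => i _.
have [di [_ ddi]] := df i.
transitivity (partial i (fun y => a * partial i f y + 0) x).
  apply: near_eq_derive; near=> y; rewrite addr0 partial_affine //.
  by apply: di; near: y; exact: open_nbhs_nbhs.
by rewrite partial_affine ?addr0 //; exact: (ddi i).1.
Unshelve. all: by end_near. Qed.

Definition sqdist (b x : 'rV[R]_d) : R := \sum_(i < d) (x 0 i - b 0 i) ^+ 2.

(** 2 a d is the Laplacian of the paraboloid that touches f at x from above. *)
Lemma laplacian_le_at_touching U f (a : R) (b x : 'rV[R]_d) :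
  open U -> U x -> Ck U 2 f ->
  (\forall y \near x, f y - a * sqdist b y <= f x - a * sqdist b x) ->
  laplacian f x <= 2 * a * d%:R.
Proof.
move=> oU Ux [_ df] fmax.
have -> : 2 * a * d%:R = \sum_(i < d) (2 * a).
  by rewrite sumr_const card_ord mulr_natr.
apply: ler_sum => i _; have [di [_ ddi]] := df i.
apply: (@directional_second_derivative_le_at_touching _ _ f _ _ _ (x 0 i - b 0 i)).
- by near=> y; apply: di; near: y; exact: open_nbhs_nbhs.
- exact: (ddi i).1.
- have := near_line (delta_mx 0 i) fmax; apply: filterS => t /=.
  suff E s : sqdist b (s *: delta_mx 0 i + x) =
      (s + (x 0 i - b 0 i)) ^+ 2 + \sum_(j < d | j != i) (x 0 j - b 0 j) ^+ 2.
    have := E 0; rewrite scale0r !add0r => ->; rewrite E; lra.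
  rewrite /sqdist (bigD1 i) //=; congr (_ + _).
    by rewrite !mxE !eqxx mulr1 addrA.
  by apply: eq_bigr => j ji; rewrite !mxE (negbTE ji) andbF mulr0 add0r.
Unshelve. all: by end_near. Qed.

End differential_calculus.

(** * Maximum principles *)

Section maximum_principles.
Context {R : realType} {d : nat}.
Implicit Types (U Omega : set 'rV[R]_d) (f : 'rV[R]_d -> R).

Lemma continuous_sqdist (b : 'rV[R]_d) : continuous (sqdist b).
Proof.
rewrite /sqdist; elim: (index_enum _) => [|i s IHs] x.
  rewrite (_ : (fun y : 'rV[R]_d => _) = cst 0); first exact: cst_continuous.
  by apply/funext => y; rewrite big_nil.
rewrite (_ : (fun y : 'rV[R]_d => _) = fun y : 'rV[R]_d => (y 0 i - b 0 i) * (y 0 i - b 0 i)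
    + \sum_(j <- s) (y 0 j - b 0 j) ^+ 2); last first.
  by apply/funext => y; rewrite big_cons.
have ci : {for x, continuous (fun y : 'rV[R]_d => y 0 i - b 0 i)}.
  have cy : {for x, continuous (fun y : 'rV[R]_d => y 0 i : R)}.
    exact: coord_continuous.
  have cb : {for x, continuous (fun y : 'rV[R]_d => b 0 i : R)}.
    exact: cst_continuous.
  exact: cvgB cy cb.
exact: cvgD (cvgM ci ci) (IHs x).
Qed.

(** The balls of row vectors are cubes (the norm is the largest coordinate);
    the paraboloids use the Euclidean distance, whose balls lie inside. *)
Lemma ball_of_sqdist (b x : 'rV[R]_d) (r : R) : 0 < r ->
  sqdist b x < r ^+ 2 -> ball b r x.
Proof.
move=> r0 xr; split=> // i j; rewrite (ord1 i) -ball_normE /=.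
have xj : (x 0 j - b 0 j) ^+ 2 < r ^+ 2.
  apply: le_lt_trans xr; rewrite /sqdist (bigD1 j) //= lerDl.
  by apply: sumr_ge0 => k _; exact: sqr_ge0.
rewrite distrC ltr_norml; apply/andP; split; nra.
Qed.

Lemma compact_cube (x0 : 'rV[R]_d) (r : R) : compact [set y | `|x0 - y| <= r].
Proof.
apply: bounded_closed_compact; last exact: closed_closed_ball_.
exists (`|x0| + r); split; first exact: num_real.
move=> M xM y /= yr; apply: le_trans (ltW xM).
by rewrite -[y](subKr x0) (le_trans (ler_normB _ _)) // lerD2l.
Qed.

Lemma compact_closure (A : set 'rV[R]_d) : bounded_set A -> compact (closure A).
Proof.
move=> [M [Mreal AM]]; apply: (subclosed_compact (@closed_closure _ A)).
  exact: (@compact_cube 0 (M + 1)).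
have /closure_id -> : closed [set y : 'rV[R]_d | `|0 - y| <= M + 1].
  exact: closed_closed_ball_.
by apply: closureS => y Ay /=; rewrite sub0r normrN; apply: AM => //; rewrite ltrDl.
Qed.

Lemma closure_open_frontier Omega x : open Omega ->
  closure Omega x -> Omega x \/ frontier Omega x.
Proof.
move=> /interior_id E cx; have [Ox|nOx] := pselect (Omega x); [by left|right].
by split; rewrite ?E.
Qed.

(** At a point of the compact closure where f is largest, either the boundary
    bound applies or the Laplacian is nonpositive. *)
Lemma weak_maximum_principle Omega f (M : R) :
  open Omega -> bounded_set Omega -> Ck Omega 2 f ->
  {within closure Omega, continuous f} ->
  (forall x, frontier Omega x -> f x <= M) ->
  (forall x, Omega x -> M < f x -> 0 < laplacian f x) ->
  forall x, Omega x -> f x <= M.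
Proof.
move=> oO bO Cf cf fM fsub x Ox.
have [|c] := compact_EVT_max (_ : closure Omega !=set0) (compact_closure bO) cf.
  by exists x; exact: subset_closure.
rewrite inE => cc cmax.
have xc : f x <= f c by apply: cmax; rewrite inE; exact: subset_closure.
apply: (le_trans xc).
have [Oc|/fM //] := closure_open_frontier oO cc.
rewrite leNgt; apply/negP => /(fsub _ Oc); rewrite ltNge => /negP; apply.
have := @laplacian_le_at_touching R d Omega f 0 0 c oO Oc Cf.
rewrite mulr0 mul0r; apply.
near=> y; rewrite !mul0r !subr0; apply: cmax; rewrite inE.
by apply: subset_closure; near: y; exact: open_nbhs_nbhs.
Unshelve. all: by end_near. Qed.

(** Let y maximize w = f - L |x - x0|^2 / r^2 over the cube. If y is at Euclidean
    distance at least r from x0 the paraboloid is at least L >= f there, so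
    w y <= 0. Otherwise y is interior, the paraboloid touches f there from above
    up to a constant, and k f y <= eps Laplacian(f) y <= 2 L d eps / r^2 unless
    f y <= 0. In all cases f x0 = w x0 <= w y is at most the bound. The hypothesis on
    the Laplacian is linear in f, hence the gain of a whole factor eps. *)
Lemma interior_bound U f (x0 : 'rV[R]_d) (r L k eps : R) :
  open U -> Ck U 2 f -> 0 < r -> 0 <= L -> 0 < k -> 0 < eps ->
  (forall y, `|x0 - y| <= r -> U y) ->
  (forall y, U y -> f y <= L) ->
  (forall y, U y -> 0 < f y -> k * f y <= eps * laplacian f y) ->
  f x0 <= 2 * L * d%:R / (k * r ^+ 2) * eps.
Proof.
move=> oU Cf r0 L0 k0 e0 BU fL fsub.
pose a := L / r ^+ 2.
have r20 : 0 < r ^+ 2 by rewrite exprn_gt0.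
have bound0 : 0 <= 2 * L * d%:R / (k * r ^+ 2) * eps.
  by rewrite mulr_ge0 ?divr_ge0 ?mulr_ge0 // ltW.
pose w y := f y - a * sqdist x0 y.
have cw : {within [set y | `|x0 - y| <= r], continuous w}.
  apply: continuous_in_subspaceT => y; rewrite inE => /= yr.
  have cfy : {for y, continuous f} := Cf.1 y (BU y yr).
  have cs : {for y, continuous (fun z => - a * sqdist x0 z + 0)}.
    by apply: continuous_at_affine; exact: continuous_sqdist.
  rewrite (_ : w = fun z => f z + (- a * sqdist x0 z + 0)).
    exact: cvgD cfy cs.
  by apply/funext => z; rewrite /w; ring.
have x0B : `|x0 - x0| <= r by rewrite subrr normr0 ltW.
have [|y] := compact_EVT_max (_ : [set y | `|x0 - y| <= r] !=set0) (@compact_cube x0 r) cw.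
  by exists x0.
rewrite inE => /= yr ymax.
have wx0 : f x0 = w x0.
  by rewrite /w /sqdist big1 ?mulr0 ?subr0 // => i _; rewrite subrr expr0n.
have xy : f x0 <= w y by rewrite wx0; apply: ymax; rewrite inE.
apply: (le_trans xy).
have [sr|sr] := ltP (sqdist x0 y) (r ^+ 2); last first.
  apply: le_trans bound0; rewrite /w subr_le0 (le_trans (fL _ (BU _ yr))) //.
  by rewrite /a mulrAC ler_pdivlMr // ler_wpM2l.
have s0 : 0 <= a * sqdist x0 y.
  rewrite mulr_ge0 ?divr_ge0 ?(ltW r20) //.
  by apply: sumr_ge0 => i _; exact: sqr_ge0.
have wf : w y <= f y by rewrite /w; lra.
apply: (le_trans wf).
have [fy|fy] := leP (f y) 0; first exact: le_trans bound0.
have yb : ball x0 r y by exact: ball_of_sqdist.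
have lapy : laplacian f y <= 2 * a * d%:R.
  apply: (laplacian_le_at_touching (b := x0) oU (BU _ yr) Cf).
  near=> z; apply: ymax; rewrite inE /=.
  have : ball x0 r z by near: z; exact: open_nbhs_nbhs (conj (ball_open _ _) yb).
  by rewrite -ball_normE /= => /ltW.
have H : k * f y <= eps * (2 * a * d%:R).
  by apply: le_trans (fsub _ (BU _ yr) fy) _; rewrite ler_pM2l.
rewrite -(ler_pM2l k0); apply: (le_trans H); rewrite le_eqVlt; apply/orP; left.
apply/eqP; rewrite /a; field; rewrite lt0r_neq0 //= lt0r_neq0 //.
Unshelve. all: by end_near. Qed.

End maximum_principles.

(** * Volume of open sets and integral bounds *)

Section lebesgue_measure_of_open_sets.
Context {R : realType}.
Local Notation T := (measurableTypeR R).

Definition box d (x : 'I_d -> R) (r : R) : set (d.-tuple T) :=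
  [set t | forall i, ball (x i) r (tnth t i : R)].

Lemma measurable_box d (x : 'I_d -> R) r : measurable (box x r).
Proof.
have -> : box x r = \bigcap_(i in [set: 'I_d]) (fun t => tnth t i) @^-1` (ball (x i) r : set T).
  by apply/seteqP; split => t /= tx i; [move=> _|]; exact: tx.
apply: fin_bigcap_measurable; first exact: finite_finset.
move=> i _; rewrite -[X in measurable X]setTI.
apply: measurable_tnth => //; exact: measurable_ball.
Qed.

Lemma lebesgue_tuple_box d (x : 'I_d -> R) (r : R) : 0 <= r ->
  lebesgue_tuple d (box x r) = ((r *+ 2) ^+ d)%:E.
Proof.
move=> r0; elim: d x => [|d IHd] x.
  by rewrite /= diracE mem_set // => -[].
rewrite /= /lebesgue_tcons /pushforward.
have -> : @tcons R d @^-1` box x r =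
    (ball (x ord0) r : set T) `*` box (x \o lift ord0) r.
  apply/seteqP; split => -[a t] /=.
    move=> H; split; first by have := H ord0.
    by move=> i; have := H (lift ord0 i); rewrite tnthS.
  move=> [ax tx] i; case: (unliftP ord0 i) => [j ->|->] //.
  by have := tx j; rewrite tnthS.
rewrite product_measure1E; [|exact: measurable_ball|exact: measurable_box].
rewrite [X in (X * _)%E](lebesgue_measure_ball _ r0) IHd -EFinM -exprS //.
Qed.

Lemma row_of_tuple_box d (x : 'rV[R]_d) (r : R) : 0 < r ->
  row_of_tuple @^-1` (ball x r) = box (x 0) r.
Proof.
move=> r0; apply/seteqP; split=> t /=.
  by move=> [_ xt] i; have := xt 0 i; rewrite mxE.
by move=> xt; split => // i j; rewrite ord1 mxE; exact: xt.
Qed.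

(** An open set is the union of the countably many cubes contained in it that
    have a rational centre and radius 1 / (k + 1). *)
Lemma measurable_open_preimage d (U : set 'rV[R]_d) : open U ->
  measurable (row_of_tuple @^-1` U : set (d.-tuple T)).
Proof.
move=> oU.
pose c (p : {ffun 'I_d -> rat} * nat) : 'rV[R]_d := \row_i ratr (p.1 i).
pose B p := ball (c p) (p.2.+1%:R^-1 : R).
have -> : U = \bigcup_(p in [set p | B p `<=` U]) B p.
  apply/seteqP; split => [x Ux|x [p] /= pU /pU //].
  have /nbhs_ballP[e /= e0 eU] : nbhs x U by exact: open_nbhs_nbhs.
  (* a cube of radius s about a point s-close to x lies in the cube of radius
     2 s < e about x *)
  have [k ke] : exists k : nat, k.+1%:R^-1 < e / 2.
    have e20 : 0 < e / 2 by rewrite divr_gt0.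
    have [k] := ltr_add_invr e20; rewrite add0r; by exists k.
  set s : R := k.+1%:R^-1 in ke.
  have s0 : 0 < s by rewrite invr_gt0.
  have /choice[q hq] : forall i : 'I_d, exists q : rat, `|ratr q - x 0 i| < s.
    move=> i; have /rat_in_itvoo[q] : x 0 i - s < x 0 i + s by lra.
    by rewrite in_itv /= => /andP[q1 q2]; exists q; rewrite ltr_distl q1 q2.
  exists ([ffun i => q i], k) => /=; last first.
    split=> // i j; rewrite (ord1 i) mxE /= ffunE -ball_normE /=; exact: hq.
  move=> y [_ /= By]; apply: eU; split => // i j; rewrite (ord1 i).
  have := By 0 j; rewrite !mxE ffunE -!ball_normE /= => yq.
  have := hq j; rewrite -/s in yq; rewrite distrC => xq.
  have := ler_distD (ratr (q j)) (x 0 j) (y 0 j); lra.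
rewrite preimage_bigcup bigcup_mkcond.
apply: countable_bigcupT_measurable => [|p].
  exact: countableP.
case: ifPn => _; last exact: measurable0.
by rewrite /B row_of_tuple_box ?invr_gt0 //; exact: measurable_box.
Qed.

Definition volume d (U : set 'rV[R]_d) : R :=
  fine (lebesgue_tuple d (row_of_tuple @^-1` U)).

Section bounded_open_set.
Variables (d : nat) (Omega : set 'rV[R]_d).
Hypotheses (oO : open Omega) (bO : bounded_set Omega).

Lemma fin_num_volume :
  (lebesgue_tuple d (row_of_tuple @^-1` Omega) \is a fin_num)%E.
Proof.
have [M [Mreal OM]] := bO.
pose r := `|M| + 2.
have r0 : 0 < r by rewrite /r; have := normr_ge0 M; lra.
have Or : Omega `<=` ball 0 r.
  move=> x Ox; rewrite -ball_normE /= sub0r normrN.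
  apply: (@le_lt_trans _ _ (`|M| + 1)); last by rewrite /r; lra.
  by apply: OM => //; have := ler_norm M; lra.
rewrite ge0_fin_numE //.
apply: (@le_lt_trans _ _ (lebesgue_tuple d (row_of_tuple @^-1` (ball 0 r)))).
  apply: le_measure; rewrite ?inE; [| |by move=> t /Or].
    exact: measurable_open_preimage.
  by apply: measurable_open_preimage; exact: ball_open.
by rewrite row_of_tuple_box // lebesgue_tuple_box ?ltW // ltry.
Qed.

Lemma volume_gt0 : Omega !=set0 -> 0 < volume Omega.
Proof.
move=> [x Ox]; have /nbhs_ballP[r /= r0 rO] : nbhs x Omega by exact: open_nbhs_nbhs.
rewrite -lte_fin /volume fineK ?fin_num_volume //.
apply: (@lt_le_trans _ _ (lebesgue_tuple d (row_of_tuple @^-1` (ball x r)))).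
  by rewrite row_of_tuple_box // lebesgue_tuple_box ?ltW // lte_fin exprn_gt0 // mulrn_wgt0.
apply: le_measure; rewrite ?inE; [| |by move=> t /rO].
  by apply: measurable_open_preimage; exact: ball_open.
exact: measurable_open_preimage.
Qed.

(** Measurability of f on Omega comes from the openness of the sets on which
    f exceeds a constant; the bounds are the integrals of constants. *)
Lemma integral_rV_bounds (f : 'rV[R]_d -> R) (m M : R) :
  (forall x, Omega x -> {for x, continuous f}) -> 0 <= m ->
  (forall x, Omega x -> m <= f x <= M) ->
  m * volume Omega <= integral_rV Omega f <= M * volume Omega.
Proof.
move=> cf m0 fmM.
pose D : set (d.-tuple T) := row_of_tuple @^-1` Omega.
have mD : measurable D by exact: measurable_open_preimage.
have mf : measurable_fun D (fun t => (f (row_of_tuple t))%:E).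
  apply/measurable_EFinP => _; apply: (measurability _ (RGenOInfty.measurableE R)) => //.
  move=> /= _ [_ [a ->] <-]; rewrite preimage_itvoy.
  suff -> : D `&` [set t | a < f (row_of_tuple t)] =
      row_of_tuple @^-1` (Omega `&` f @^-1` [set y | a < y]).
    apply: measurable_open_preimage.
    have cO : {in Omega, continuous f} by move=> x; rewrite inE => /cf.
    by apply: ((continuous_inP f oO).1 cO); exact: open_gt.
  by [].
have cst_int c : (\int[lebesgue_tuple d]_(t in D) c%:E = c%:E * lebesgue_tuple d D)%E.
  exact: integral_cst.
have lo : (m%:E * lebesgue_tuple d D <= \int[lebesgue_tuple d]_(t in D) (f (row_of_tuple t))%:E)%E.
  rewrite -(cst_int m); apply: ge0_le_integral => //.
  by move=> t /fmM /andP[]; rewrite lee_fin.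
have hi : (\int[lebesgue_tuple d]_(t in D) (f (row_of_tuple t))%:E <= M%:E * lebesgue_tuple d D)%E.
  rewrite -(cst_int M); apply: ge0_le_integral => //.
  - by move=> t /fmM /andP[mt _]; rewrite lee_fin (le_trans m0).
  - by move=> t /fmM /andP[]; rewrite lee_fin.
have vE : lebesgue_tuple d D = (volume Omega)%:E by rewrite fineK // fin_num_volume.
rewrite vE -!EFinM in lo hi.
rewrite /integral_rV /Rintegral -/D -!lee_fin fineK ?lo ?hi //.
rewrite ge0_fin_numE; first by apply: le_lt_trans hi _; exact: ltry.
by apply: le_trans lo; rewrite lee_fin mulr_ge0 // fine_ge0.
Qed.

End bounded_open_set.

End lebesgue_measure_of_open_sets.

(** * Distance from a compact set to the boundary *)

Section topology.
Context {R : realType} {V : normedModType R}.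

Lemma compact_uniform_radius (K U : set V) : compact K -> open U -> K `<=` U ->
  exists2 r : R, 0 < r & forall x y, K x -> `|x - y| <= r -> U y.
Proof.
move=> /compact_near_coveringP cK oU KU.
have : \forall r \near (0:R)^'+, K `<=` [set x | forall y, `|x - y| <= r -> U y].
  apply: cK => x Kx.
  have /nbhs_ballP[e /= e0 eU] : nbhs x U by apply: open_nbhs_nbhs; split=> //; exact: KU.
  near=> x' r => y x'y; apply: eU.
  have xx' : ball x (e / 2) x'.
    by near: x'; apply: nbhsx_ballx; rewrite divr_gt0.
  have re : r < e / 2 by near: r; apply: nbhs_right_lt; rewrite divr_gt0.
  move: xx'; rewrite -!ball_normE /= => xx'.
  apply: (le_lt_trans (ler_distD x' x y)); rewrite (splitr e).
  exact: ltr_leD xx' (le_trans x'y (ltW re)).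
move=> H; have [r [r0 Kr]] : exists r : R, 0 < r /\
    K `<=` [set x | forall y, `|x - y| <= r -> U y].
  apply: (@filter_ex _ (0:R)^'+); apply: filterI H; exact: nbhs_right_gt.
by exists r => // x y Kx; exact: Kr.
Unshelve. all: by end_near. Qed.

End topology.

(** * Estimates for one solution, uniform in eps *)

Section a_priori_estimates.
Context {R : realType} {d : nat}.
Variables (Omega : set 'rV[R]_d) (W : 'rV[R]_d -> R) (I1 Z2 : R).
Hypotheses (oO : open Omega) (bO : bounded_set Omega) (O0 : Omega !=set0).
Hypotheses (I1_gt0 : 0 < I1) (Z2_gt0 : 0 < Z2).
Variable M : R.
Hypothesis WM : forall x, frontier Omega x -> `|W x| <= M.
Variables (eps : R) (Phi : 'rV[R]_d -> R).
Hypotheses (eps_gt0 : 0 < eps) (sol : PB_solution Omega W I1 Z2 eps Phi).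

Let mass := integral_rV Omega (fun y => expR (- Phi y)).

(** The value of the potential at which the two ionic densities cancel, the
    nonlocal coefficient I1 / mass being kept fixed. *)
Definition equilibrium := ln (I1 * Z2 / mass) / 2.
Local Notation c := equilibrium.

Let Phi_continuous : {within closure Omega, continuous Phi}.
Proof. by case: sol => /smooth_on_continuous. Qed.

Let Phi_C2 : Ck Omega 2 Phi.
Proof. by case: sol => sP _ _; exact: smooth_on_Ck (@subset_closure _ Omega) sP. Qed.

Lemma mass_bounds (lo hi : R) : (forall x, Omega x -> lo <= Phi x <= hi) ->
  expR (- hi) * volume Omega <= mass <= expR (- lo) * volume Omega.
Proof.
move=> Philh; apply: integral_rV_bounds => //; first last.
  by move=> x /Philh /andP[lx xh]; rewrite !ler_expR !lerN2 xh.
move=> x Ox; apply: (@continuous_comp _ _ _ (fun y => - Phi y) expR).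
  exact/continuousN/(Phi_C2.1 _ Ox).
exact: continuous_expR.
Qed.

(** These bounds may depend on eps. They give mass > 0, without which the
    equilibrium value, and so the uniform bounds, would not make sense. *)
Lemma Phi_bounded : exists lo hi, forall x, Omega x -> lo <= Phi x <= hi.
Proof.
have cO : closure Omega !=set0 by case: O0 => x Ox; exists x; exact: subset_closure.
have [a _ Pa] := compact_EVT_min cO (compact_closure bO) Phi_continuous.
have [b _ Pb] := compact_EVT_max cO (compact_closure bO) Phi_continuous.
exists (Phi a), (Phi b) => x Ox.
by rewrite Pa ?Pb // inE; exact: subset_closure.
Qed.

Lemma mass_gt0 : 0 < mass.
Proof.
have [lo [hi /mass_bounds /andP[+ _]]] := Phi_bounded.
by apply: lt_le_trans; rewrite mulr_gt0 ?expR_gt0 ?volume_gt0.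
Qed.

Lemma mass_equilibrium : expR c ^+ 2 * mass = I1 * Z2.
Proof.
have A0 := mass_gt0.
rewrite -expRM_natl /c [2%:R * _]mulrC divfK // lnK; last first.
  by rewrite posrE divr_gt0 ?mulr_gt0.
by rewrite divfK // gt_eqF.
Qed.

Lemma PB_density_equilibrium x : PB_density Omega I1 Z2 Phi x =
  - (expR c / Z2 * (expR (Phi x - c) - expR (- (Phi x - c)))).
Proof.
have A0 := mass_gt0; rewrite /PB_density -/mass.
have -> : I1 = expR c ^+ 2 * mass / Z2 by rewrite mass_equilibrium mulfK // gt_eqF.
rewrite opprB !expRD !expRN; field.
by rewrite !gt_eqF ?expR_gt0.
Qed.

(** The factor s treats Phi - c and c - Phi together; the affine shape
    s Phi + b is the one under which the Laplacian is computed. *)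
Lemma laplacian_signed_deviation (s : R) x : s = 1 \/ s = -1 -> Omega x ->
  eps * laplacian (fun y => s * Phi y + - s * c) x =
  expR c / Z2 * (expR (s * Phi x + - s * c) - expR (- (s * Phi x + - s * c))).
Proof.
move=> s1 Ox; rewrite (laplacian_affine _ _ oO Ox Phi_C2).
have [_ /(_ x Ox) E _] := sol.
have {}E : eps * laplacian Phi x =
    expR c / Z2 * (expR (Phi x - c) - expR (- (Phi x - c))).
  by rewrite -[RHS]opprK -PB_density_equilibrium -E mulNr opprK.
rewrite mulrCA E; case: s1 => ->; rewrite ?opprK !mul1r ?mulN1r //.
by rewrite -[Phi x - c]opprB !opprK [- Phi x + c]addrC; ring.
Qed.

Lemma signed_deviation_le (s N : R) : s = 1 \/ s = -1 -> 0 <= N ->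
  (forall x, frontier Omega x -> s * Phi x + - s * c <= N) ->
  forall x, Omega x -> s * Phi x + - s * c <= N.
Proof.
move=> s1 N0 fN; apply: (weak_maximum_principle oO bO _ _ fN).
- exact: Ck_affine.
- move=> x; apply: (@continuous_at_affine R (subspace (closure Omega)) Phi).
  exact: Phi_continuous.
move=> x Ox Nx; have w0 := le_lt_trans N0 Nx.
rewrite -(pmulr_rgt0 _ eps_gt0) laplacian_signed_deviation //.
by rewrite mulr_gt0 ?divr_gt0 ?expR_gt0 // subr_gt0 ltr_expR; lra.
Qed.

Lemma Phi_between x : Omega x ->
  Num.min (- M) c <= Phi x <= Num.max M c.
Proof.
have [_ _ PW] := sol; move=> Ox; apply/andP; split.
  have : -1 * Phi x + - (-1) * c <= c - Num.min (- M) c.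
    apply: signed_deviation_le; [by right|by rewrite subr_ge0 ge_min lexx orbT| |exact: Ox].
    move=> y Fy; rewrite (PW _ Fy); have := WM Fy; rewrite ler_norml => /andP[MW _].
    have : Num.min (- M) c <= - M by rewrite ge_min lexx.
    lra.
  lra.
have : 1 * Phi x + - 1 * c <= Num.max M c - c.
  apply: signed_deviation_le; [by left|by rewrite subr_ge0 le_max lexx orbT| |exact: Ox].
  move=> y Fy; rewrite (PW _ Fy); have := WM Fy; rewrite ler_norml => /andP[_ MW].
  have : M <= Num.max M c by rewrite le_max lexx.
  lra.
lra.
Qed.

(** The only constant that solves the equation in Omega: a constant potential
    equal to it is its own equilibrium. *)
Definition neutral := ln (I1 * Z2 / volume Omega).
Definition upper := Num.max M neutral.
Definition lower := Num.min (- M) neutral.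

Lemma expR_neutral : expR neutral * volume Omega = I1 * Z2.
Proof.
have v0 := volume_gt0 oO bO O0.
by rewrite lnK ?posrE ?divr_gt0 ?mulr_gt0 // divfK // gt_eqF.
Qed.

(** If c exceeds the boundary data then Phi <= c, so mass >= exp (- c) |Omega|,
    and exp (2 c) mass = I1 Z2 gives exp c <= I1 Z2 / |Omega|. *)
Lemma equilibrium_le : c <= upper.
Proof.
have v0 := volume_gt0 oO bO O0.
rewrite /upper le_max; have [//|Mc] := leP c M.
have Pc x : Omega x -> Num.min (- M) c <= Phi x <= c.
  by move=> /Phi_between; rewrite (max_r (ltW Mc)).
have /andP[lo _] := mass_bounds Pc.
rewrite -ler_expR -(ler_pM2r v0) expR_neutral -mass_equilibrium.
have := ler_wpM2l (ltW (exprn_gt0 2 (expR_gt0 c))) lo.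
apply: le_trans; rewrite mulrA expRN expr2 mulfK // gt_eqF ?expR_gt0 //.
Qed.

Lemma equilibrium_ge : lower <= c.
Proof.
have v0 := volume_gt0 oO bO O0.
rewrite /lower ge_min; have [//|cM] := leP (- M) c.
have Pc x : Omega x -> c <= Phi x <= Num.max M c.
  by move=> /Phi_between; rewrite (min_r (ltW cM)).
have /andP[_ hi] := mass_bounds Pc.
rewrite -ler_expR -(ler_pM2r v0) expR_neutral -mass_equilibrium.
apply: (le_trans (ler_wpM2l (ltW (exprn_gt0 2 (expR_gt0 c))) hi)).
by rewrite mulrA expRN expr2 mulfK // gt_eqF ?expR_gt0.
Qed.

Lemma Phi_bounds x : Omega x -> lower <= Phi x <= upper.
Proof.
move=> /Phi_between /andP[lo hi]; apply/andP; split.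
  by apply: le_trans lo; rewrite le_min equilibrium_ge /lower ge_min lexx.
by apply: (le_trans hi); rewrite ge_max equilibrium_le /upper le_max lexx.
Qed.

Definition decay_constant (r : R) : R :=
  2 * (upper - lower) * d%:R / (expR lower / Z2 * r ^+ 2).

(** Since exp w - exp (- w) >= w for w >= 0 and c >= lower, both w = Phi - c and
    w = c - Phi satisfy the linear inequality of interior_bound with
    k = exp lower / Z2. *)
Lemma deviation_le (x0 : 'rV[R]_d) (r : R) : 0 < r ->
  (forall y, `|x0 - y| <= r -> Omega y) ->
  `|Phi x0 - c| <= decay_constant r * eps.
Proof.
move=> r0 BO.
have [cl cu] := (equilibrium_ge, equilibrium_le).
have H s : s = 1 \/ s = -1 -> s * Phi x0 + - s * c <= decay_constant r * eps.
  move=> s1; apply: (interior_bound (L := upper - lower) (r := r) oO (Ck_affine s (- s * c) oO Phi_C2)).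
  - exact: r0.
  - by rewrite subr_ge0 (le_trans cl).
  - by rewrite divr_gt0 ?expR_gt0.
  - exact: eps_gt0.
  - exact: BO.
  - by move=> y /Phi_bounds /andP[? ?]; case: s1 => ->; lra.
  move=> y Oy w0; rewrite laplacian_signed_deviation //.
  set w := s * Phi y + - s * c in w0 *.
  apply: ler_pM; [by rewrite divr_ge0 ?expR_ge0 ?ltW|exact: ltW| |].
    by rewrite ler_pM2r ?invr_gt0 // ler_expR.
  have := expR_ge1Dx w; have : expR (- w) <= 1.
    by rewrite -expR0 ler_expR oppr_le0 ltW.
  lra.
have := H 1 (or_introl erefl); have := H (-1) (or_intror erefl).
by rewrite ler_norml => ? ?; apply/andP; split; lra.
Qed.

Lemma PB_density_le (x0 : 'rV[R]_d) (r : R) : 0 < r ->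
  (forall y, `|x0 - y| <= r -> Omega y) ->
  `|PB_density Omega I1 Z2 Phi x0| <= expR upper / Z2 *
    (expR (decay_constant r * eps) - expR (- (decay_constant r * eps))).
Proof.
move=> r0 /(deviation_le r0); set b := decay_constant r * eps => ub.
rewrite PB_density_equilibrium normrN normrM ger0_norm; last first.
  by rewrite divr_ge0 ?expR_ge0 // ltW.
apply: ler_pM; rewrite ?normr_ge0 // ?divr_ge0 ?expR_ge0 ?(ltW Z2_gt0) //.
  by rewrite ler_pM2r ?invr_gt0 // ler_expR equilibrium_le.
move: ub; set u := Phi x0 - c; rewrite ler_norml => /andP[u1 u2].
have h1 : expR u <= expR b by rewrite ler_expR.
have h2 : expR (- u) <= expR b by rewrite ler_expR; lra.
have h3 : expR (- b) <= expR u by rewrite ler_expR; lra.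
have h4 : expR (- b) <= expR (- u) by rewrite ler_expR; lra.
by rewrite ler_norml; apply/andP; split; lra.
Qed.

End a_priori_estimates.

Lemma smooth_on_frontier_bounded (R : realType) d (Omega : set 'rV[R]_d)
    (W : 'rV[R]_d -> R) : bounded_set Omega -> smooth_on (frontier Omega) W ->
  exists M, forall x, frontier Omega x -> `|W x| <= M.
Proof.
move=> bO /smooth_on_continuous cW.
have cF : compact (frontier Omega).
  apply: (subclosed_compact _ (compact_closure bO)); last by move=> x [].
  apply: closedI; first exact: closed_closure.
  by apply: open_closedC; exact: open_interior.
have [N [_ WN]] := compact_bounded (continuous_compact cW cF).
by exists (N + 1) => x Fx; apply: WN; [rewrite ltrDl|exists x].
Qed.

(** * Local electroneutrality as eps tends to 0 *)

Unset Implicit Arguments.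

Theorem theorem4 (R : realType) (d : nat) (hd : d = 2%N \/ d = 3%N)
  (Omega : set 'rV[R]_d)
  (Omega_open : open Omega) (Omega_connected : connected Omega)
  (Omega_bounded : bounded_set Omega) (Omega_smooth : smooth_boundary Omega)
  (W : 'rV[R]_d -> R) (W_smooth : smooth_on (frontier Omega) W)
  (I1 Z2 : R) (I1_gt0 : 0 < I1) (Z2_gt0 : 0 < Z2)
  (Phi : R -> 'rV[R]_d -> R)
  (Phi_solution : forall eps : R, 0 < eps ->
     PB_solution Omega W I1 Z2 eps (Phi eps))
  (K : set 'rV[R]_d) (K_compact : compact K) (K_sub : K `<=` Omega) :
  sup [set `|PB_density Omega I1 Z2 (Phi eps) x| | x in K]
    @[eps --> (0 : R)^'+] --> (0 : R).
Proof.
(* the supremum of the empty set is 0 by convention *)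
have [[z Kz]|/nonemptyPn K0] := pselect (K !=set0); last first.
  have -> : (fun eps : R => sup [set `|PB_density Omega I1 Z2 (Phi eps) x| | x in K]) = cst 0.
    by apply/funext => eps; rewrite K0 image_set0 sup0.
  exact: cvg_cst.
have O0 : Omega !=set0 by exists z; exact: K_sub.
have [M WM] := smooth_on_frontier_bounded Omega_bounded W_smooth.
have [r r0 KO] := compact_uniform_radius K_compact Omega_open K_sub.
pose C := decay_constant Omega I1 Z2 M r.
pose D := expR (upper Omega I1 Z2 M) / Z2.
have est eps x : 0 < eps -> K x ->
    `|PB_density Omega I1 Z2 (Phi eps) x| <= D * (expR (C * eps) - expR (- (C * eps))).
  move=> eps0 Kx; apply: (PB_density_le Omega_open Omega_bounded O0 I1_gt0 Z2_gt0 WM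
    eps0 (Phi_solution _ eps0) r0) => y; exact: KO.
apply: (@squeeze_cvgr _ _ _ _ (cst 0) (fun eps => D * (expR (C * eps) - expR (- (C * eps))))).
- near=> eps; have eps0 : 0 < eps by near: eps; exact: nbhs_right_gt.
  have ub : ubound [set `|PB_density Omega I1 Z2 (Phi eps) x| | x in K]
      (D * (expR (C * eps) - expR (- (C * eps)))).
    by move=> _ [x Kx <-]; exact: est.
  apply/andP; split.
    apply: le_trans (normr_ge0 (PB_density Omega I1 Z2 (Phi eps) z)) _.
    apply: ub_le_sup; last by exists z.
    by eexists; exact: ub.
  by apply: ge_sup ub; eexists; exists z.
- exact: cvg_cst.
have cC : (C * eps) @[eps --> (0:R)] --> C * 0.
  by apply: cvgM; [exact: cvg_cst|exact: cvg_id].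
have cD : D * (expR (C * eps) - expR (- (C * eps))) @[eps --> (0:R)] -->
    D * (expR (C * 0) - expR (- (C * 0))).
  apply: cvgM; first exact: cvg_cst.
  apply: cvgB; apply: continuous_cvg; try exact: continuous_expR.
    exact: cC.
  exact: cvgN cC.
rewrite mulr0 oppr0 subrr mulr0 in cD; exact: cvg_at_right_filter cD.
Unshelve. all: by end_near. Qed.
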